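(* Let $\mathscr S$ be an operator system and $\mathscr T$ a unital $C^*$-algebra. For each $r\in\mathbb N$, let $\tau_r$ denote the locally convex topology on $\mathcal E$ generated by the seminorms $$p_{k,f,s}(\Phi)=\big|f(\Phi_k(s))\big|$$ with $1\le k\le r$, $f\in S(M_k(\mathscr T))$, and $s\in M_k(\mathscr S)$. Then, for every $r\ge1$, $$\tau_r=\tau_1=\tau.$$ Equivalently, every seminorm $p_{k,f,s}$ with $k\in\mathbb N$, $f\in S(M_k(\mathscr T))$, $s\in M_k(\mathscr S)$ is $\tau_1$-continuous.
   Context: $\mathrm{CP}(\mathscr S,\mathscr T)$ is the set of all completely positive linear maps $\mathscr S\to\mathscr T$, and $\mathcal E=\mathrm{span}_{\mathbb C}(\mathrm{CP}(\mathscr S,\mathscr T))$, a complex vector space of linear maps $\mathscr S\to\mathscr T$. For a linear map $\Phi:\mathscr S\to\mathscr T$ and $k\in\mathbb N$ ($k\ge1$), $\Phi_k:M_k(\mathscr S)\to M_k(\mathscr T)$ is $\Phi_k([s_{ij}])=[\Phi(s_{ij})]$. $S(M_k(\mathscr T))$ is the state space of $M_k(\mathscr T)$ (positive linear functionals $f$ with $f(\mathbb 1)=1$). $\tau$ is the locally convex topology on $\mathcal E$ generated by the seminorms $p_{k,f,s}$ over all $k\in\mathbb N$, $f\in S(M_k(\mathscr T))$, $s\in M_k(\mathscr S)$. *)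

(* Defs.v *)
From HB Require Import structures.
From mathcomp Require Import all_boot all_order all_algebra.
From mathcomp Require Import complex.
From mathcomp Require Import boolp classical_sets functions reals.
From mathcomp Require Import interval_inference topology.
From mathcomp Require Import normedtype convex.

Set Implicit Arguments.
Unset Strict Implicit.
Unset Printing Implicit Defensive.

Import Order.TTheory GRing.Theory Num.Theory.
Import numFieldNormedType.Exports ComplexField.

Local Open Scope classical_set_scope.
Local Open Scope ring_scope.

(* A seminorm on a complex vector space; nonnegativity follows. *)
Definition is_seminorm (R : realType) (E : lmodType R[i]) (p : E -> R) : Prop :=
  (forall x y, p (x + y) <= p x + p y) /\
  (forall (c : R[i]) x, p (c *: x) = Normc.normc c * p x).

Record seminorm_family (R : realType) (E : lmodType R[i]) := SeminormFamily {
  seminorms : set (E -> R);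
  seminormsP : forall p, seminorms p -> is_seminorm p }.

Lemma normcE (R : realType) (c : R[i]) : `|c| = (Normc.normc c)%:C%C.
Proof. by case: c. Qed.

Lemma normc_ge0 (R : realType) (c : R[i]) : 0 <= Normc.normc c.
Proof. by case: c => a b; exact: sqrtr_ge0. Qed.

Section SeminormTheory.
Context (R : realType) (E : lmodType R[i]) (p : E -> R).
Hypothesis sp : is_seminorm p.

Lemma seminorm0 : p 0 = 0.
Proof. by rewrite -(scale0r 0) sp.2 Normc.normc0 mul0r. Qed.

Lemma seminormN x : p (- x) = p x.
Proof. by rewrite -scaleN1r sp.2 normcN Normc.normc1 mul1r. Qed.

Lemma seminorm_ge0 x : 0 <= p x.
Proof.
have := sp.1 x (- x); rewrite subrr seminorm0 seminormN -mulr2n.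
by rewrite pmulrn_lge0.
Qed.

End SeminormTheory.

Definition seminorm_ball (R : realType) (E : lmodType R[i])
    (ps : seq (E -> R)) (e : R) (x : E) : set E :=
  [set y | forall p, p \in ps -> p (y - x) < e].

(* The vector space E with the locally convex topology generated by P: the
   finite intersections of P-balls around x are a neighborhood base of x. *)
Definition seminorm_tvs (R : realType) (E : lmodType R[i])
  (P : seminorm_family E) : Type := E.

Section SeminormTopology.
Context (R : realType) (E : lmodType R[i]) (P : seminorm_family E).

Local Notation V := (seminorm_tvs P).

HB.instance Definition _ := GRing.Lmodule.on V.

Definition seminorm_nbhs (x : V) : set_system V :=
  [set U | exists ps e, [/\ {in ps, forall p, seminorms P p}, 0 < e &
     seminorm_ball ps e x `<=` U]].

HB.instance Definition _ := hasNbhs.Build V seminorm_nbhs.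

Let seminorm_filter (x : V) : ProperFilter (nbhs x).
Proof.
split.
  case=> ps [e [Pps e0 /(_ x)]]; apply=> p pps.
  by rewrite subrr (seminorm0 (seminormsP (Pps _ pps))).
split.
- by exists [::], 1; split.
- move=> U W [ps [e [Pps e0 sU]]] [qs [d [Pqs d0 sW]]].
  exists (ps ++ qs), (Num.min e d); split.
  + by move=> p; rewrite mem_cat => /orP[/Pps|/Pqs].
  + by rewrite lt_min e0.
  + move=> y yB; split; [apply: sU|apply: sW] => p pin.
      have /yB : p \in ps ++ qs by rewrite mem_cat pin.
      by rewrite lt_min => /andP[].
    have /yB : p \in ps ++ qs by rewrite mem_cat pin orbT.
    by rewrite lt_min => /andP[].
- move=> U W UW [ps [e [Pps e0 sU]]]; exists ps, e; split=> //.
  exact: subset_trans UW.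
Qed.

Let seminorm_singleton (x : V) (U : set V) : nbhs x U -> U x.
Proof.
case=> ps [e [Pps e0]]; apply=> p pps.
by rewrite subrr (seminorm0 (seminormsP (Pps _ pps))).
Qed.

Let seminorm_nbhs_nbhs (x : V) (U : set V) : nbhs x U -> nbhs x (nbhs^~ U).
Proof.
case=> ps [e [Pps e0 sU]]; exists ps, (e / 2); split=> //.
  by rewrite divr_gt0.
move=> y yx; exists ps, (e / 2); split=> //; first by rewrite divr_gt0.
move=> z zy; apply: sU => p pps.
have -> : z - x = (z - y) + (y - x) by rewrite addrA subrK.
apply: le_lt_trans ((seminormsP (Pps _ pps)).1 _ _) _.
by rewrite [e]splitr ltrD// ?zy ?yx.
Qed.

HB.instance Definition _ := Nbhs_isNbhsTopological.Build V
  seminorm_filter seminorm_singleton seminorm_nbhs_nbhs.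

Let filter_all T (F : set_system T) (ps : seq (E -> R)) (Q : (E -> R) -> set T) :
  Filter F -> (forall p, p \in ps -> F (Q p)) ->
  F [set y | forall p, p \in ps -> Q p y].
Proof.
move=> FF; elim: ps => [|p ps IH] FQ; first by apply: filterS filterT.
have FQs : F [set y | forall q, q \in ps -> Q q y].
  by apply: IH => q qps; apply: FQ; rewrite in_cons qps orbT.
have FQp : F (Q p) by apply: FQ; rewrite mem_head.
apply: filterS (filterI FQp FQs) => y [Qpy Qsy] q.
by rewrite in_cons => /predU1P[->|/Qsy].
Qed.

Let seminorm_add_continuous : continuous (fun x : V * V => x.1 + x.2).
Proof.
move=> [x y] U [ps [e [Pps e0 sU]]]; have e20 : 0 < e / 2 by rewrite divr_gt0.
exists (seminorm_ball ps (e / 2) x, seminorm_ball ps (e / 2) y).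
  by split; exists ps, (e / 2); split.
move=> [u v] [/= ux vy]; apply: sU => p pps.
rewrite opprD addrACA; apply: le_lt_trans ((seminormsP (Pps _ pps)).1 _ _) _.
by rewrite [e]splitr ltrD// ?ux ?vy.
Qed.

Let seminorm_scale_continuous :
  continuous (fun z : R[i]^o * V => z.1 *: z.2).
Proof.
move=> [a x] U [ps [e [Pps e0 sU]]] /=.
pose Q (p : E -> R) := [set z : R[i]^o * V | p (z.1 *: z.2 - a *: x) < e].
suff : nbhs ((a : R[i]^o), x) [set z | forall p, p \in ps -> Q p z].
  by apply: filterS => z zQ; apply: sU => p /zQ.
apply: filter_all => p pps; have sp := seminormsP (Pps _ pps).
pose d := Num.min 1 (e / 2 / (p x + 1)).
have px1 : 0 < p x + 1 by rewrite ltr_wpDl// seminorm_ge0.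
have a1 : 0 < Normc.normc a + 1 by rewrite ltr_wpDl// normc_ge0.
have d0 : 0 < d by rewrite lt_min ltr01 !divr_gt0.
have dC0 : 0 < d%:C%C by rewrite ltcR.
exists (ball (a : R[i]^o) d%:C%C,
        seminorm_ball [:: p] (e / 2 / (Normc.normc a + 1)) x).
  split; first exact: nbhsx_ballx.
  exists [:: p], (e / 2 / (Normc.normc a + 1)); split=> //.
    by move=> q; rewrite inE => /eqP->; exact: Pps.
  by rewrite !divr_gt0.
move=> [b z] [/= ab zx]; rewrite /Q /=.
have {}zx := zx p (mem_head _ _).
have {}ab : Normc.normc (b - a) < d.
  move: ab; rewrite /ball /= distrC.
  by rewrite normcE ltcR.
have -> : b *: z - a *: x = b *: (z - x) + (b - a) *: x.
  by rewrite scalerBr scalerBl addrA subrK.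
apply: le_lt_trans (sp.1 _ _) _; rewrite !sp.2 [e]splitr ltr_leD//.
- apply: (@le_lt_trans _ _ ((Normc.normc a + 1) * p (z - x))).
    rewrite ler_wpM2r ?seminorm_ge0//.
    rewrite -[b](subrKC a) (le_trans (le_normcD _ _))// lerD2l.
    by rewrite (le_trans (ltW ab))// /d ge_min lexx.
  by rewrite mulrC -ltr_pdivlMr.
- apply: (@le_trans _ _ (d * (p x + 1))).
    by rewrite ler_pM ?normc_ge0 ?seminorm_ge0 ?ltW// ?ltrDl.
  by rewrite -ler_pdivlMr// /d ge_min lexx orbT.
Qed.

Let seminorm_locally_convex :
  exists2 B : set_system V, (forall b, b \in B -> convex_set b) & basis B.
Proof.
exists [set U : set V | exists ps e x, [/\ {in ps, forall p, seminorms P p}, 0 < e &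
    U = seminorm_ball ps e x]].
  move=> _ /set_mem[ps [e [x [Pps e0 ->]]]] y z l /set_mem yx /set_mem zx.
  apply/mem_set => p pps; have sp := seminormsP (Pps _ pps).
  have l0 : 0 <= l%:num by [].
  have l1 : l%:num <= 1 by [].
  have splitx : conv l y z - x =
      l%:num *: (y - x) + (1 - l%:num) *: (z - x) :> E.
    change (conv l y z) with
      (l%:num *: (y : E) + (1 - l%:num) *: (z : E)).
    by rewrite !scalerBr addrACA -opprD -scalerDl subrKC scale1r.
  rewrite splitx; apply: le_lt_trans (sp.1 _ _) _; rewrite !sp.2.
  have ye := yx p pps; have ze := zx p pps.
  have [t lE] : exists t : R, l%:num = t%:C%C.
    by exists (complex.Re l%:num); rewrite RRe_real// ger0_real.
  have lE1 : 1 - l%:num = (1 - t)%:C%C by rewrite lE rmorphB rmorph1.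
  have t0 : 0 <= t by rewrite -lecR -lE.
  have t1 : 0 <= 1 - t by rewrite -lecR -lE1 subr_ge0.
  have n0 s : 0 <= s -> Normc.normc s%:C%C = s.
    by move=> s0; rewrite /Normc.normc /= expr0n addr0 sqrtr_sqr ger0_norm.
  rewrite lE1 lE !n0//.
  have [->|tn1] := eqVneq t 1; first by rewrite subrr mul0r addr0 mul1r.
  have -> : e = t * e + (1 - t) * e by rewrite -mulrDl subrKC mul1r.
  rewrite ler_ltD//; first by rewrite ler_wpM2l// ltW.
  by rewrite ltr_pM2l// lt_neqAle eq_sym subr_eq0 eq_sym tn1.
split.
- move=> _ [ps [e [x [Pps e0 ->]]]]; rewrite openE => y yx.
  apply: (@filter_all _ (nbhs y) ps (fun p => [set z | p (z - x) < e])) => p pps.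
  have sp := seminormsP (Pps _ pps).
  exists [:: p], (e - p (y - x)); split.
  + by move=> q; rewrite inE => /eqP->; exact: Pps.
  + by rewrite subr_gt0 yx.
  + move=> z /(_ p (mem_head _ _)); rewrite /= ltrBrDr; apply: le_lt_trans.
    by rewrite (le_trans _ (sp.1 _ _))// addrA subrK.
- move=> x U [ps [e [Pps e0 sU]]].
  exists (seminorm_ball ps e x) => //; split; first by exists ps, e, x.
  move=> p pps.
  by rewrite subrr (seminorm0 (seminormsP (Pps _ pps))).
Qed.

(* PreTopologicalLmod_isTvs only provides the uniform structure. *)
HB.instance Definition _ := PreTopologicalLmod_isTvs.Build R[i] V
  seminorm_add_continuous seminorm_scale_continuous seminorm_locally_convex.
HB.instance Definition _ :=
  PreTopologicalNmodule_isTopologicalNmodule.Build V seminorm_add_continuous.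
HB.instance Definition _ := TopologicalNmodule_isTopologicalLmodule.Build
  R[i] V seminorm_scale_continuous.
HB.instance Definition _ := Uniform_isTvs.Build R[i] V seminorm_locally_convex.

End SeminormTopology.

HB.mixin Record hasAdjoint (R : realType) V & GRing.Lmodule R[i] V := {
  adj : V -> V;
  adjK : involutive adj;
  adjD : {morph adj : x y / x + y};
  adjZ : forall (c : R[i]) x, adj (c *: x) = (c^*)%R *: adj x }.

#[short(type="starLmodType")]
HB.structure Definition StarLmodule (R : realType) :=
  {V of GRing.Lmodule R[i] V & hasAdjoint R V}.

(* The vector space 'M[V]_n of a complex vector space V.  MathComp only scales
   'M[V]_n by the entries of a ring V, hence mxscale. *)
Section MatrixSpace.
Context (R : realType).

Definition mxscale (V : lmodType R[i]) m n (c : R[i]) (X : 'M[V]_(m, n)) :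
  'M[V]_(m, n) := map_mx ( *:%R c) X.

Definition mxadj (V : starLmodType R) m n (X : 'M[V]_(m, n)) : 'M[V]_(n, m) :=
  (map_mx adj X)^T.

(* A^* X A *)
Definition mxcompress (V : lmodType R[i]) m n (A : 'M[R[i]]_(n, m))
    (X : 'M[V]_n) : 'M[V]_m :=
  \matrix_(i, j) \sum_k \sum_l ((A k i)^* * A l j) *: X k l.

End MatrixSpace.

(* Operator systems in the sense of Choi and Effros: a matrix-ordered complex
   *-vector space with an Archimedean matrix order unit.  For scalars in R[i],
   0 <= c means that c is real and nonnegative.  The axioms force
   os_cone 0 = [set 0], so that allowing n = 0 adds nothing. *)
HB.mixin Record isOperatorSystem (R : realType) S & StarLmodule R S := {
  os_cone : forall n, set 'M[S]_n;
  os_unit : S;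
  os_cone_herm : forall n X, os_cone n X -> mxadj X = X;
  os_coneD : forall n X Y, os_cone n X -> os_cone n Y -> os_cone n (X + Y);
  os_coneZ : forall n (c : R[i]) X, 0 <= c -> os_cone n X ->
    os_cone n (mxscale c X);
  os_cone_proper : forall n X, os_cone n X -> os_cone n (- X) -> X = 0;
  os_cone_compress : forall m n (A : 'M[R[i]]_(n, m)) X,
    os_cone n X -> os_cone m (mxcompress A X);
  os_unit_herm : adj os_unit = os_unit;
  os_order_unit : forall n (X : 'M[S]_n), mxadj X = X ->
    exists2 c : R[i], 0 < c & os_cone n (mxscale c os_unit%:M - X);
  os_archimedean : forall n (X : 'M[S]_n), mxadj X = X ->
    (forall c : R[i], 0 < c -> os_cone n (mxscale c os_unit%:M + X)) ->
    os_cone n X }.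

#[short(type="operatorSystemType")]
HB.structure Definition OperatorSystem (R : realType) :=
  {S of StarLmodule R S & isOperatorSystem R S}.

(* Unital C*-algebras.  The norm is a field of the mixin because the library has
   no structure joining algType and completeNormedModType; cstar_complete is
   completeness with respect to it. *)
HB.mixin Record isCStarAlgebra (R : realType) A
    & GRing.Algebra R[i] A & StarLmodule R A := {
  adjM : forall x y : A, adj (x * y) = adj y * adj x;
  cstar_norm : A -> R;
  cstar_normD : forall x y : A,
    cstar_norm (x + y) <= cstar_norm x + cstar_norm y;
  cstar_normZ : forall (c : R[i]) (x : A),
    cstar_norm (c *: x) = Normc.normc c * cstar_norm x;
  cstar_norm_eq0 : forall x : A, cstar_norm x = 0 -> x = 0;
  cstar_normM : forall x y : A,
    cstar_norm (x * y) <= cstar_norm x * cstar_norm y;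
  cstar_norm_adj : forall x : A, cstar_norm (adj x * x) = cstar_norm x ^+ 2;
  cstar_complete : forall u : nat -> A,
    (forall e : R, 0 < e -> exists N, forall m n, (N <= m)%N -> (N <= n)%N ->
      cstar_norm (u m - u n) < e) ->
    exists l : A, (fun n => cstar_norm (u n - l)) @ \oo --> (0 : R) }.

#[short(type="cstarAlgType")]
HB.structure Definition CStarAlgebra (R : realType) :=
  {A of GRing.Algebra R[i] A & StarLmodule R A & isCStarAlgebra R A}.

(* The positive elements of the C*-algebra M_k(T). *)
Definition mx_positive (R : realType) (T : cstarAlgType R) k : set 'M[T]_k :=
  [set X | exists Y : 'M[T]_k, X = mxadj Y *m Y].

Definition is_state (R : realType) (T : cstarAlgType R) k
    (f : 'M[T]_k -> R[i]) : Prop :=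
  [/\ forall c X Y, f (mxscale c X + Y) = c * f X + f Y,
      forall X, mx_positive X -> 0 <= f X
    & f 1%:M = 1].

Section CPSpan.
Context (R : realType) (S : operatorSystemType R) (T : cstarAlgType R).

Definition completely_positive (Phi : {linear S -> T}) : Prop :=
  forall k (X : 'M[S]_k), os_cone k X -> mx_positive (map_mx Phi X).

Definition cp_span : {pred S -> T} :=
  [pred Phi | `[< exists n (c : 'I_n -> R[i]) (F : 'I_n -> {linear S -> T}),
    (forall i, completely_positive (F i)) /\
    Phi = \sum_i c i *: (F i : S -> T) >]].

Lemma cp_span_submod_closed : submod_closed cp_span.
Proof.
split=> [|a f g].
  apply/asboolP; exists 0, (fun=> 0), (fun=> \0); split; first by case.
  by rewrite big_ord0.
move=> /asboolP[n [c [F [cpF ->]]]] /asboolP[m [d [G [cpG ->]]]].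
apply/asboolP; exists (n + m)%N, (fun i : 'I_(n + m) => match fintype.split i with
  | inl j => a * c j | inr j => d j end), (fun i : 'I_(n + m) => match fintype.split i with
  | inl j => F j | inr j => G j end); split.
  by move=> i; case: fintype.split.
rewrite big_split_ord /= scaler_sumr; congr (_ + _); apply: eq_bigr => i _.
  by rewrite (unsplitK (inl i)) scalerA.
by rewrite (unsplitK (inr i)).
Qed.

HB.instance Definition _ :=
  GRing.isSubmodClosed.Build R[i] (S -> T) cp_span cp_span_submod_closed.

Record cpSpace := CPSpace { cp_fun :> S -> T; _ : cp_fun \in cp_span }.

HB.instance Definition _ := [isSub for cp_fun].
HB.instance Definition _ := [Choice of cpSpace by <:].
HB.instance Definition _ := [SubChoice_isSubLmodule of cpSpace by <:].

Definition cp_seminorm k (f : 'M[T]_k -> R[i]) (s : 'M[S]_k) (Phi : cpSpace) :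
  R := Normc.normc (f (map_mx Phi s)).

Lemma cp_seminormP k (f : 'M[T]_k -> R[i]) (s : 'M[S]_k) :
  is_state f -> is_seminorm (cp_seminorm f s).
Proof.
case=> flin _ _.
have scale1 X : mxscale 1 X = X by apply/matrixP => i j; rewrite mxE scale1r.
have fD X Y : f (X + Y) = f X + f Y by rewrite -{1}[X]scale1 flin mul1r.
have f0 : f 0 = 0 by apply: (addrI (f 0)); rewrite -fD !addr0.
have fZ c X : f (mxscale c X) = c * f X.
  by rewrite -[mxscale c X]addr0 flin f0 addr0.
split=> [Phi Psi|c Phi]; rewrite /cp_seminorm.
  have -> : map_mx (Phi + Psi) s = map_mx Phi s + map_mx Psi s.
    by apply/matrixP => i j; rewrite !mxE.
  by rewrite fD le_normcD.
have -> : map_mx (c *: Phi) s = mxscale c (map_mx Phi s).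
  by apply/matrixP => i j; rewrite !mxE.
by rewrite fZ Normc.normcM.
Qed.

Definition cp_seminorms (K : set nat) : set (cpSpace -> R) :=
  [set p | exists k f s, [/\ K k, @is_state R T k f & p = cp_seminorm f s]].

Lemma cp_seminormsP (K : set nat) p : cp_seminorms K p -> is_seminorm p.
Proof. by case=> k [f [s [_ stf ->]]]; exact: cp_seminormP. Qed.

Definition cp_seminorm_family (K : set nat) : seminorm_family cpSpace :=
  SeminormFamily (@cp_seminormsP K).

Definition tau_upto (r : nat) : tvsType R[i] :=
  seminorm_tvs (cp_seminorm_family [set k | (1 <= k <= r)%N]).

Definition tau : tvsType R[i] :=
  seminorm_tvs (cp_seminorm_family [set k | (1 <= k)%N]).

End CPSpan.

(* The open sets, with the topological space explicit: several topologies on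
   the same carrier are compared. *)
Definition opens_of (X : topologicalType) : set (set X) := open.
Arguments opens_of X : clear implicits.

(* Main.v *)
Require Import Defs.
From HB Require Import structures.
From mathcomp Require Import all_boot all_order all_algebra.
From mathcomp Require Import complex.
From mathcomp Require Import boolp classical_sets functions reals.
From mathcomp Require Import interval_inference topology normedtype convex.
From mathcomp Require Import ring.

(* For a state f on M_k(T) and a row vector c, the map t |-> f (c^* c (x) t) is
   positive on T.  By polarization over c = e_i + 'i^m e_j with m < 4, f is a
   finite linear combination of such functionals evaluated at matrix entries;
   after normalization they are states on T = M_1(T).  Hence each seminorm
   p_{k,f,s} is at most a finite combination of level-one seminorms. *)

Set Implicit Arguments.
Unset Strict Implicit.
Unset Printing Implicit Defensive.

Import Order.TTheory GRing.Theory Num.Theory.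
Import numFieldNormedType.Exports.

Local Open Scope classical_set_scope.
Local Open Scope ring_scope.

(** * Domination of seminorms and comparison of the generated topologies *)

Section SeminormDomination.
Context (R : realType) (E : lmodType R[i]).

Definition seminorm_dominated (P : seminorm_family E) (p : E -> R) : Prop :=
  exists (I : finType) (C : I -> R) (q : I -> E -> R),
    [/\ forall i, 0 <= C i, forall i, seminorms P (q i)
      & forall x, p x <= \sum_i C i * q i x].

Lemma nbhs_seminorm_dominated (P : seminorm_family E) p (x : seminorm_tvs P)
    (e : R) : seminorm_dominated P p -> 0 < e ->
  nbhs x [set y | p (y - x) < e].
Proof.
move=> [I [C [q [C0 Pq pq]]]] e0.
have sC0 : 0 < \sum_i C i + 1 by rewrite ltr_wpDl// sumr_ge0.
(* If every [q i] is below this radius, the weighted sum is at most (sum C) / (sum C + 1) times [e];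
   the + 1 covers the case where all [C i] vanish. *)
exists [seq q i | i <- enum I], (e / (\sum_i C i + 1)); split.
- by move=> _ /mapP[i _ ->].
- exact: divr_gt0.
- move=> y yx /=; apply: (le_lt_trans (pq _)).
  apply: (@le_lt_trans _ _ ((\sum_i C i) * (e / (\sum_i C i + 1)))).
    rewrite mulr_suml; apply: ler_sum => i _; apply: ler_wpM2l => //.
    by apply/ltW/yx/map_f; rewrite mem_enum.
  by rewrite mulrA ltr_pdivrMr// mulrC ltr_pM2l// ltrDl.
Qed.

Lemma seminorm_dominated_opens (P Q : seminorm_family E) :
  (forall p, seminorms P p -> seminorm_dominated Q p) ->
  opens_of (seminorm_tvs P) `<=` opens_of (seminorm_tvs Q).
Proof.
move=> PQ U; rewrite /opens_of !openE => oU x Ux.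
have [ps [e [Pps e0 sU]]] : nbhs (x : seminorm_tvs P) U by exact: oU.
(* Indexing the ball's seminorms by a finite ordinal turns it into a finite intersection of
   neighborhoods. *)
have : nbhs (x : seminorm_tvs Q)
    [set y | forall i : 'I_(size ps), ps`_i (y - x) < e].
  apply: (@filter_forall _ _ (fun (i : 'I_(size ps)) y => ps`_i (y - x) < e)
    (nbhs (x : seminorm_tvs Q))) => i; apply: nbhs_seminorm_dominated => //.
  by apply: PQ; apply: Pps; exact: mem_nth.
apply: filterS => y yx; apply: sU => p pps.
have ips : (index p ps < size ps)%N by rewrite index_mem.
by have := yx (Ordinal ips); rewrite /= nth_index.
Qed.

Lemma seminorm_dominated_continuous (P : seminorm_family E) p :
  is_seminorm p -> seminorm_dominated P p ->
  continuous (p : seminorm_tvs P -> R).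
Proof.
move=> sp Pp x.
apply/(@cvgrPdist_lt _ _ (seminorm_tvs P) (nbhs (x : seminorm_tvs P)) _) => e e0.
have := nbhs_seminorm_dominated x Pp e0.
apply: (@filterS _ (nbhs (x : seminorm_tvs P))) => y /=.
(* Reverse triangle inequality: [p x] and [p y] differ by at most [p (y - x)]. *)
apply: le_lt_trans; rewrite ler_norml lerNl opprB !lerBlDr; apply/andP; split.
  by have := sp.1 (y - x) x; rewrite subrK.
by rewrite -(seminormN sp (y - x)) opprB; have := sp.1 (x - y) y; rewrite subrK.
Qed.

End SeminormDomination.

(** * States on M_k(T) as combinations of states on T *)

Section StateDecomposition.
Context (R : realType) (T : cstarAlgType R).

Lemma adj0 : adj (0 : T) = 0.
Proof. by apply: (addrI (adj (0 : T))); rewrite -adjD !addr0. Qed.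

Lemma adj1 : adj (1 : T) = 1.
Proof. by rewrite -[LHS]mulr1 -[X in _ * X](adjK 1) -adjM mulr1 adjK. Qed.

Lemma state_sum k (f : 'M[T]_k -> R[i]) (I : Type) (r : seq I)
    (a : I -> R[i]) (X : I -> 'M[T]_k) : is_state f ->
  f (\sum_(i <- r) mxscale (a i) (X i)) = \sum_(i <- r) a i * f (X i).
Proof.
case=> flin _ _; elim: r => [|i r IH]; last by rewrite !big_cons flin IH.
rewrite !big_nil; have := flin 1 0 0.
rewrite mul1r addr0 (_ : mxscale 1 0 = 0).
  by rewrite -[X in X = _]addr0 => /addrI.
by apply/matrixP => a' b; rewrite !mxE scaler0.
Qed.

Definition rank1_mx k (c : 'I_k -> R[i]) (t : T) : 'M[T]_k :=
  \matrix_(a, b) (((c a)^* * c b) *: t).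

Lemma mx_positive_scalar k (y : T) : mx_positive ((adj y * y)%:M : 'M[T]_k).
Proof.
exists y%:M; rewrite /mxadj.
have -> : (map_mx adj y%:M)^T = (adj y)%:M :> 'M_k.
  apply/matrixP => a b; rewrite !mxE eq_sym.
  by case: eqP => _; rewrite ?mulr1n// mulr0n adj0.
by rewrite -scalar_mxM.
Qed.

(** The witness Y has the single nonzero row c (x) y, so that Y^* Y = c^* c (x) y^* y; since k > 0,
    there is a row to hold it. *)
Lemma mx_positive_rank1 k (c : 'I_k -> R[i]) (y : T) :
  (0 < k)%N -> mx_positive (rank1_mx c (adj y * y)).
Proof.
move=> k0; pose i := Ordinal k0.
exists (\matrix_(l, b) if l == i then c b *: y else 0).
apply/matrixP => a b; rewrite /mxadj !mxE (bigD1 i)//= big1 ?addr0.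
  by rewrite !mxE eqxx Defs.adjZ -scalerAl -scalerAr scalerA.
by move=> l /negPf li; rewrite !mxE li mulr0.
Qed.

Lemma mx_positive1E (X : 'M[T]_1) :
  mx_positive X -> exists y, X 0 0 = adj y * y.
Proof.
by case=> Y ->; exists (Y 0 0); rewrite !mxE big_ord1 !mxE.
Qed.

(* Adding the scalar matrix keeps the normalizing constant positive, so that
   no Cauchy-Schwarz argument is needed when [f (rank1_mx c 1) = 0]; its
   contribution cancels in the polarization ([N] in [polarization] below). *)
Definition compressed_state k (f : 'M[T]_k -> R[i]) (c : 'I_k -> R[i])
    (X : 'M[T]_1) : R[i] :=
  (f (rank1_mx c 1) + 1)^-1 * f (rank1_mx c (X 0 0) + (X 0 0)%:M).

Lemma state_rank1_gt0 k (f : 'M[T]_k -> R[i]) (c : 'I_k -> R[i]) :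
  (0 < k)%N -> is_state f -> 0 < f (rank1_mx c 1) + 1.
Proof.
move=> k0 [_ fpos _]; rewrite ltr_wpDl//; apply: fpos.
have -> : 1 = adj 1 * 1 :> T by rewrite adj1 mulr1.
exact: mx_positive_rank1.
Qed.

(** A positive 1 x 1 matrix has entry y^* y, which makes both summands inside [f] positive in
    M_k(T); the inverse factor normalizes the value at 1. *)
Lemma compressed_stateP k (f : 'M[T]_k -> R[i]) (c : 'I_k -> R[i]) :
  (0 < k)%N -> is_state f -> is_state (compressed_state f c).
Proof.
move=> k0 stf; have := state_rank1_gt0 c k0 stf.
case: (stf) => flin fpos f1 c0.
have fD X Y : f (X + Y) = f X + f Y.
  have -> : X = mxscale 1 X by apply/matrixP => a b; rewrite mxE scale1r.
  by rewrite flin mul1r; congr (f _ + _); apply/matrixP => a b; rewrite !mxE !scale1r.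
split.
- move=> a X Y; rewrite /compressed_state mulrCA -mulrDr -flin; congr (_ * f _).
  apply/matrixP => i j; rewrite !mxE mulrnDl !scalerDr addrACA scalerMnr.
  by rewrite !scalerA [a * _]mulrC.
- move=> X /mx_positive1E[y Xy]; rewrite /compressed_state Xy fD.
  apply: mulr_ge0; first by rewrite invr_ge0 ltW.
  apply: addr_ge0; apply: fpos; last exact: mx_positive_scalar.
  exact: mx_positive_rank1.
- by rewrite /compressed_state mxE eqxx mulr1n fD f1 mulVf// gt_eqF.
Qed.

(** On expansion, A * D has constant coefficient 1/4, while A * C, B * D and N carry (- 'i)^m and B
    * C carries (-1)^m, and these powers sum to 0 over m < 4. *)
Lemma polarization (N A B C D : R[i]) :
  \sum_(m < 4) 4^-1 * (- 'i) ^+ m *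
    ((A + (- 'i) ^+ m * B) * (C + 'i ^+ m * D) + N) = A * D.
Proof.
have i2 : 'i * 'i = -1 :> R[i] by rewrite -expr2 sqrCi.
rewrite !big_ord_recl big_ord0 /= /bump /= !exprS expr0.
by field: i2.
Qed.

Definition polar_vec k (p : 'I_k * 'I_k * 'I_4) (a : 'I_k) : R[i] :=
  (a == p.1.1)%:R + 'i ^+ p.2 * (a == p.1.2)%:R.

Lemma mx_polarization k (X : 'M[T]_k) :
  X = \sum_(p : 'I_k * 'I_k * 'I_4) mxscale (4^-1 * (- 'i) ^+ p.2)
    (rank1_mx (polar_vec p) (X p.1.1 p.1.2) + (X p.1.1 p.1.2)%:M).
Proof.
apply/matrixP => a b; rewrite summxE.
(* At the entry (a, b), [polarization] with N = (a == b) reduces the coefficient of X q.1 q.2 to (a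
   == q.1) * (b == q.2), so only q = (a, b) survives. *)
transitivity (\sum_q \sum_(m < 4) (4^-1 * (- 'i) ^+ m *
    ((((a == q.1)%:R + (- 'i) ^+ m * (a == q.2)%:R) *
      ((b == q.1)%:R + 'i ^+ m * (b == q.2)%:R)) + (a == b)%:R)) *: X q.1 q.2
  : T).
  under eq_bigr do rewrite -scaler_suml polarization.
  rewrite (bigD1 (a, b))//= !eqxx mulr1 scale1r big1 ?addr0//.
  move=> [i j] /=; rewrite xpair_eqE negb_and !(eq_sym _ a) !(eq_sym _ b).
  by case/orP=> /negPf->; rewrite ?mul0r ?mulr0 scale0r.
rewrite pair_bigA /=; apply: eq_bigr => p _.
rewrite !mxE /polar_vec -(scaler_nat _ (X _ _)) -scalerDl scalerA.
by rewrite rmorphD rmorphM rmorphXn /= !conjC_nat conjCi.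
Qed.

(** The last factor undoes the normalization of [compressed_state]. *)
Definition polar_coef k (f : 'M[T]_k -> R[i]) (p : 'I_k * 'I_k * 'I_4) : R[i] :=
  4^-1 * (- 'i) ^+ p.2 * (f (rank1_mx (polar_vec p) 1) + 1).

Lemma state_decomposition k (f : 'M[T]_k -> R[i]) (X : 'M[T]_k) :
  (0 < k)%N -> is_state f ->
  f X = \sum_p polar_coef f p *
    compressed_state f (polar_vec p) (const_mx (X p.1.1 p.1.2)).
Proof.
move=> k0 stf; rewrite [in LHS](mx_polarization X) (state_sum _ _ _ stf).
apply: eq_bigr => p _; rewrite /polar_coef /compressed_state mxE.
by rewrite -[RHS]mulrA mulVKf// gt_eqF// state_rank1_gt0.
Qed.

End StateDecomposition.

(** * Level-one domination and equality of the topologies *)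

Lemma cp_seminorm_dominated (R : realType) (S : operatorSystemType R)
    (T : cstarAlgType R) k (f : 'M[T]_k -> R[i]) (s : 'M[S]_k) (K : set nat) :
  (0 < k)%N -> is_state f -> K 1 ->
  seminorm_dominated (cp_seminorm_family S T K) (cp_seminorm f s).
Proof.
move=> k0 stf K1; exists ('I_k * 'I_k * 'I_4)%type.
exists (fun p => Normc.normc (polar_coef f p)).
(* The (i, j) entry of Phi_k(s) is Phi applied to s i j, so each term of [state_decomposition] is a
   level-one seminorm at that entry. *)
exists (fun p => cp_seminorm (compressed_state f (polar_vec R p))
                             (const_mx (s p.1.1 p.1.2))).
split=> [p|p|Phi]; first exact: normc_ge0.
  exists 1, (compressed_state f (polar_vec R p)), (const_mx (s p.1.1 p.1.2)).
  by split=> //; exact: compressed_stateP.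
rewrite {1}/cp_seminorm state_decomposition//.
have normc_sum (I : Type) (r : seq I) (F : I -> R[i]) :
    Normc.normc (\sum_(i <- r) F i) <= \sum_(i <- r) Normc.normc (F i).
  elim: r => [|i r IH]; first by rewrite !big_nil Normc.normc0.
  by rewrite !big_cons (le_trans (le_normcD _ _))// lerD2l.
apply: (le_trans (normc_sum _ _ _)); apply: ler_sum => p _.
by rewrite Normc.normcM /cp_seminorm map_const_mx mxE.
Qed.

Theorem proposition2p8 (R : realType) (S : operatorSystemType R)
    (T : cstarAlgType R) :
  (forall r : nat, (1 <= r)%N ->
     opens_of (tau_upto S T r) = opens_of (tau_upto S T 1) /\
     opens_of (tau_upto S T 1) = opens_of (tau S T)) /\
  (forall (k : nat) (f : 'M[T]_k -> R[i]) (s : 'M[S]_k),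
     (1 <= k)%N -> is_state f ->
     continuous (cp_seminorm f s : tau_upto S T 1 -> R)).
Proof.
(* Only level 1 is required of L, so two sets of positive levels that both contain 1 can be
   exchanged; this gives both inclusions of each equality. *)
have finer (K L : set nat) : (forall k, K k -> (0 < k)%N) -> L 1 ->
    opens_of (seminorm_tvs (cp_seminorm_family S T K)) `<=`
    opens_of (seminorm_tvs (cp_seminorm_family S T L)).
  move=> K0 L1; apply: seminorm_dominated_opens => _ [k [f [s [Kk stf ->]]]].
  exact: cp_seminorm_dominated (K0 _ Kk) stf L1.
split=> [r r1|k f s k1 stf].
  pose U n : set nat := [set k | (1 <= k <= n)%N].
  have U0 n k : U n k -> (0 < k)%N by case/andP.
  split; apply/seteqP; split.
  - exact: (finer (U r) (U 1) (U0 r)).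
  - exact: (finer (U 1) (U r) (U0 1)).
  - exact: (finer (U 1) [set k | (1 <= k)%N] (U0 1)).
  - exact: (finer [set k | (1 <= k)%N] (U 1)).
apply: seminorm_dominated_continuous; first exact: cp_seminormP.
exact: cp_seminorm_dominated.
Qed.
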